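(* If $S$ is a nilpotent-free semiring and $P$ is a prime ideal of $S$, then $P$ is a minimal prime ideal of $S$ if and only if for each $x\in P$ there exists a $y\in S$ with $y\notin P$ such that $xy=0$.
   Context: A semiring is a set $S$ with operations $+,\cdot$ such that $(S,+)$ is a commutative monoid with identity $0$, $(S,\cdot)$ is a commutative monoid with identity $1\neq 0$, multiplication distributes over addition, and $s\cdot 0=0$ for all $s\in S$. A semiring is nilpotent-free if $s^n=0$ for some positive integer $n$ implies $s=0$. A nonempty subset $I\subseteq S$ is an ideal if $a+b\in I$ and $sa\in I$ for all $a,b\in I$, $s\in S$. An ideal $P\neq S$ is prime if $ab\in P$ implies $a\in P$ or $b\in P$. A minimal prime ideal of $S$ is a prime ideal that is minimal with respect to inclusion among all prime ideals of $S$. *)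

(* Defs.v *)
From HB Require Import structures.
From mathcomp Require Import all_boot all_algebra.
From mathcomp Require Import boolp classical_sets.

Set Implicit Arguments.
Unset Strict Implicit.
Unset Printing Implicit Defensive.

Import GRing.Theory.

Local Open Scope classical_set_scope.
Local Open Scope ring_scope.

(* "Semiring" means commutative semiring with 0 absorbing and 1 != 0, that is,
   [comNzSemiRingType].  Ideals are arbitrary (Prop-valued) subsets; the prime
   ideals of ring_quotient.v are decidable and need a ring. *)

Definition nilpotent_free (S : comNzSemiRingType) : Prop :=
  forall (s : S) (n : nat), (0 < n)%N -> s ^+ n = 0 -> s = 0.

Definition semiring_ideal (S : comNzSemiRingType) (I : set S) : Prop :=
  [/\ I !=set0,
      forall a b : S, I a -> I b -> I (a + b)
    & forall s a : S, I a -> I (s * a)].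

Definition prime_ideal (S : comNzSemiRingType) (P : set S) : Prop :=
  [/\ semiring_ideal P,
      P <> setT
    & forall a b : S, P (a * b) -> P a \/ P b].

Definition minimal_prime_ideal (S : comNzSemiRingType) (P : set S) : Prop :=
  prime_ideal P /\
  forall Q : set S, prime_ideal Q -> Q `<=` P -> Q = P.

(* Main.v *)
(* The nontrivial direction: if [x] in a minimal prime [P] had no annihilator
   outside [P], nilpotent-freeness would make the multiplicative set of all
   [x^n y] with [y] outside [P] avoid [0].  An ideal maximal among those disjoint
   from this set is prime, lies inside [P] and misses [x], contradicting the
   minimality of [P]. *)
Require Import Defs.
From mathcomp Require Import all_boot all_algebra.
From mathcomp Require Import boolp classical_sets.

Import GRing.Theory.

Local Open Scope classical_set_scope.
Local Open Scope ring_scope.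

Section Ideals.
Set Implicit Arguments.
Unset Strict Implicit.
Variable S : comNzSemiRingType.
Implicit Types (I M P : set S) (a x y : S).

Lemma semiring_ideal0 I : semiring_ideal I -> I 0.
Proof. by case=> -[a Ia] _ /(_ 0 a Ia); rewrite mul0r. Qed.

Lemma prime_ideal_not1 P : prime_ideal P -> ~ P 1.
Proof.
move=> [[_ _ mulP] PnT _] P1; apply: PnT; rewrite -subTset => a _.
by rewrite -[a]mulr1; apply: mulP.
Qed.

(** When [I] is an ideal, this is the ideal generated by [I] and [a]. *)
Definition ideal_adjoin I a : set S := [set i + s * a | i in I & s in setT].

Lemma semiring_ideal_adjoin I a :
  semiring_ideal I -> semiring_ideal (ideal_adjoin I a).
Proof.
move=> idI; have I0 := semiring_ideal0 idI; case: idI => _ addI mulI; split.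
- by exists (0 + 0 * a), 0 => //; exists 0.
- move=> _ _ [i Ii [s _ <-]] [j Ij [t _ <-]].
  by exists (i + j); [exact: addI|exists (s + t) => //; rewrite mulrDl addrACA].
- move=> r _ [i Ii [s _ <-]].
  by exists (r * i); [exact: mulI|exists (r * s) => //; rewrite mulrDr mulrA].
Qed.

Lemma sub_ideal_adjoin I a : I `<=` ideal_adjoin I a.
Proof. by move=> i Ii; exists i => //; exists 0 => //; rewrite mul0r addr0. Qed.

Lemma mem_ideal_adjoin I a : semiring_ideal I -> ideal_adjoin I a a.
Proof.
move=> /semiring_ideal0 I0; exists 0 => //.
by exists 1 => //; rewrite mul1r add0r.
Qed.

(** In the expansion of [(i + s * a) * (j + t * b)] every term has a factor in [I] or is a multiple
    of [a * b]. *)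
Lemma ideal_adjoin_mul I a b x y : semiring_ideal I -> I (a * b) ->
  ideal_adjoin I a x -> ideal_adjoin I b y -> I (x * y).
Proof.
move=> [_ addI mulI] Iab [i Ii [s _ <-]] [j Ij [t _ <-]].
rewrite mulrDr; apply: (addI); first exact: mulI.
rewrite mulrDl; apply: addI; first by rewrite mulrC; exact: mulI.
by rewrite mulrACA; exact: mulI.
Qed.

Lemma exists_maximal_disjoint_ideal M : ~ M 0 ->
  exists I, [/\ semiring_ideal I, I `<=` ~` M &
    forall J, semiring_ideal J -> J `<=` ~` M -> I `<=` J -> J = I].
Proof.
move=> M0.
(* [Zorn_bigcup] also takes the union of the empty chain, so the empty set has
   to be admitted as a candidate. *)
pose D I := [/\ forall a b, I a -> I b -> I (a + b),
  forall s a, I a -> I (s * a) & I `<=` ~` M].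
have [F FD totF|I [[addI mulI IM] maxI]] := @Zorn_bigcup S D.
  split.
  - move=> a b [I FI Ia] [J FJ Jb].
    have [IJ|JI] := totF _ _ FI FJ.
      by exists J => //; have [addJ _ _] := FD _ FJ; apply: addJ => //; apply: IJ.
    by exists I => //; have [addI _ _] := FD _ FI; apply: addI => //; apply: JI.
  - by move=> s a [I FI Ia]; exists I => //; have [_ mulI _] := FD _ FI; apply: mulI.
  - by move=> a [I FI Ia]; have [_ _ IM] := FD _ FI; apply: IM.
(* Were [I] empty, [[set 0]] would be a strictly larger candidate, because [M] misses [0]. *)
have In0 : I !=set0.
  apply/set0P/eqP => I0; apply: (maxI [set 0]).
    by rewrite I0; split=> [//|/(_ 0 erefl)].
  split.
  - by move=> a b -> ->; rewrite /= addr0.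
  - by move=> s a ->; rewrite /= mulr0.
  - by move=> a ->.
exists I; split=> // J [_ addJ mulJ] JM IJ.
apply: contrapT => JI; apply: (maxI J) => //.
by split=> // JsubI; apply: JI; apply/seteqP.
Qed.

(** Take [Q] maximal among the ideals disjoint from [M]. If [a] and [b] lie outside [Q], adjoining
    either one gives an ideal that meets [M], say in [x] and [y]. Then [x * y] is in [M], but
    [a * b] in [Q] would put it in [Q]. *)
Lemma exists_prime_ideal_disjoint M : M 1 -> ~ M 0 ->
  (forall a b, M a -> M b -> M (a * b)) ->
  exists2 Q : set S, prime_ideal Q & Q `<=` ~` M.
Proof.
move=> M1 M0 mulM.
have [Q [idQ QM maxQ]] := exists_maximal_disjoint_ideal M0.
exists Q => //; split=> // [QT|a b Qab].
  by apply: (QM 1) => //; rewrite QT.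
have adjoinM c : ~ Q c -> exists2 x, ideal_adjoin Q c x & M x.
  move=> Qc; apply: contrapT => noM; apply: Qc.
  rewrite -(maxQ (ideal_adjoin Q c)); first exact: mem_ideal_adjoin.
  - exact: semiring_ideal_adjoin.
  - by move=> x Qcx Mx; apply: noM; exists x.
  - exact: sub_ideal_adjoin.
apply: contrapT => /not_orP[/adjoinM[x Qx Mx] /adjoinM[y Qy My]].
by apply: (QM (x * y)); [exact: ideal_adjoin_mul Qx Qy|exact: mulM].
Qed.

(** The power [(x * y) ^+ n.+1] factors as [(x ^+ n * y) * (x * y ^+ n)]. *)
Lemma nilpotent_free_exprM_eq0 x y n : nilpotent_free S ->
  x ^+ n * y = 0 -> x * y = 0.
Proof.
move=> nilS xny; apply: (nilS _ n.+1) => //.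
by rewrite exprMn exprSr exprS mulrACA xny mul0r.
Qed.

End Ideals.

Theorem corollary3p6 (S : comNzSemiRingType) (hS : nilpotent_free S)
    (P : set S) (hP : prime_ideal P) :
  minimal_prime_ideal P <->
  (forall x : S, P x -> exists y : S, ~ P y /\ x * y = 0).
Proof.
have [idP _ primeP] := hP; split=> [[_ minP] x Px|annP].
  apply: contrapT => noann.
  pose M := [set z | exists n y, ~ P y /\ z = x ^+ n * y].
  have P1 := prime_ideal_not1 hP.
  (* The exponent [0] puts the complement of [P] inside [M], so an ideal avoiding [M] lies in
     [P]. *)
  have sPM y : ~ P y -> M y by move=> Py; exists 0, y; rewrite mul1r.
  have M0 : ~ M 0.
    move=> [n [y [Py /esym xny]]]; apply: noann; exists y; split=> //.
    exact: nilpotent_free_exprM_eq0 xny.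
  have mulM a b : M a -> M b -> M (a * b).
    move=> [n [y [Py ->]]] [m [z [Pz ->]]]; exists (n + m)%N, (y * z).
    by split; [case/primeP|rewrite exprD mulrACA].
  have [Q primeQ QM] := exists_prime_ideal_disjoint (sPM _ P1) M0 mulM.
  have QP : Q `<=` P.
    by move=> z Qz; apply: contrapT => /sPM; exact: QM.
  (* Minimality gives [Q = P], which contains [x]; yet [x = x ^+ 1 * 1] is in [M], as [1] is outside
     [P]. *)
  apply: (QM x); first by rewrite (minP Q).
  by exists 1%N, 1; rewrite mulr1.
split=> // Q [idQ _ primeQ] QP; apply/seteqP; split=> // x Px.
have [y [Py xy0]] := annP x Px.
(* As [Q] is prime and contains [0], it contains [x] or [y]; the latter is excluded by [Q] lying in
   [P]. *)
have /primeQ[//|/QP//] : Q (x * y) by rewrite xy0; exact: semiring_ideal0.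
Qed.
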